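(* Let $\mu\ge0$, $s>0$ with $\mu s<1$. Then there is a constant $K>0$ (depending only on $\mu$ and $s$) such that the following holds. Let $f:\mathbb{R}^n\to\mathbb{R}$ be continuously differentiable, $\mu$-strongly convex (possibly $\mu=0$) and $(1/s)$-smooth, with a minimizer $x^*$. Put $\iota=-\frac{\log(1-\sqrt{\mu s})}{\sqrt{\mu s}}$ if $\mu>0$ and $\iota=1$ if $\mu=0$. Let the iterates of the unified NAG be generated from $x_0=z_0\in\mathbb{R}^n$ by, for $k\ge0$, $$y_k=x_k+\frac{\frac{2}{\iota(k+1)}\operatorname{cothc}\left(\frac{k+1}{2}\iota\sqrt{\mu s}\right)-\mu s}{1-\mu s}(z_k-x_k),\qquad x_{k+1}=y_k-s\nabla f(y_k),$$ $$z_{k+1}=z_k+\frac{\iota s(k+1)}{2}\operatorname{tanhc}\left(\frac{k+1}{2}\iota\sqrt{\mu s}\right)\left(\mu y_k-\mu z_k-\nabla f(y_k)\right).$$ Then for all $k\ge1$, $$f(x_k)-f(x^* )\le K\min\left\{\frac{1}{k^2},\left(1-\sqrt{\mu s}\right)^k\right\}\|x_0-x^*\|^2.$$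
   Context: $\operatorname{tanhc}(x)=\tanh(x)/x$ for $x\ne0$, $\operatorname{tanhc}(0)=1$; $\operatorname{cothc}(x)=1/\operatorname{tanhc}(x)$. $f$ is $\mu$-strongly convex if $f(y)\ge f(x)+\langle\nabla f(x),y-x\rangle+\frac{\mu}{2}\|y-x\|^2$ for all $x,y$; $f$ is $L$-smooth if $\nabla f$ is $L$-Lipschitz. *)

(* Defs.v *)
From HB Require Import structures.
From mathcomp Require Import all_boot all_order all_algebra.
From mathcomp Require Import all_classical all_reals all_analysis.

Set Implicit Arguments.
Unset Strict Implicit.
Unset Printing Implicit Defensive.

Import Order.TTheory GRing.Theory Num.Theory.
Import numFieldNormedType.Exports.

Local Open Scope classical_set_scope.
Local Open Scope ring_scope.

Definition tanh (R : realType) (x : R) : R :=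
  (expR x - expR (- x)) / (expR x + expR (- x)).

Definition tanhc (R : realType) (x : R) : R :=
  if x == 0 then 1 else tanh x / x.

Definition cothc (R : realType) (x : R) : R := 1 / tanhc x.

Definition dotv (R : realType) (n : nat) (u v : 'rV[R]_n) : R :=
  \sum_(i < n) u 0 i * v 0 i.

(* The norm `|v| that the library puts on 'rV[R]_n is the sup norm, so the
   Euclidean norm is defined separately; the two induce the same topology and
   the same notion of differentiability. *)
Definition enorm (R : realType) (n : nat) (v : 'rV[R]_n) : R :=
  Num.sqrt (dotv v v).

Definition gradient (R : realType) (n : nat) (f : 'rV[R]_n -> R)
    (x : 'rV[R]_n) : 'rV[R]_n :=
  \row_(i < n) 'D_(delta_mx 0 i) f x.

Definition continuously_differentiable (R : realType) (n : nat)
    (f : 'rV[R]_n -> R) : Prop :=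
  (forall x, differentiable f x) /\ continuous (gradient f).

(* Meaningful for differentiable f; mu = 0 is allowed and is convexity. *)
Definition strongly_convex (R : realType) (n : nat) (mu : R)
    (f : 'rV[R]_n -> R) : Prop :=
  forall x y : 'rV[R]_n,
    f y >= f x + dotv (gradient f x) (y - x) + mu / 2 * enorm (y - x) ^+ 2.

Definition smooth (R : realType) (n : nat) (L : R)
    (f : 'rV[R]_n -> R) : Prop :=
  forall x y : 'rV[R]_n,
    enorm (gradient f x - gradient f y) <= L * enorm (x - y).

Definition is_minimizer (R : realType) (n : nat) (f : 'rV[R]_n -> R)
    (xstar : 'rV[R]_n) : Prop :=
  forall x : 'rV[R]_n, f xstar <= f x.

Definition nag_iota (R : realType) (mu s : R) : R :=
  if 0 < mu then - (ln (1 - Num.sqrt (mu * s)) / Num.sqrt (mu * s)) else 1.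

Definition unified_NAG (R : realType) (n : nat) (mu s : R)
    (f : 'rV[R]_n -> R) (x y z : nat -> 'rV[R]_n) : Prop :=
  let io := nag_iota mu s in
  let t k := (k.+1)%:R / 2 * io * Num.sqrt (mu * s) in
  x 0%N = z 0%N /\
  forall k : nat,
    [/\ y k = x k +
          ((2 / (io * (k.+1)%:R) * cothc (t k) - mu * s) / (1 - mu * s))
            *: (z k - x k),
        x k.+1 = y k - s *: gradient f (y k)
      & z k.+1 = z k +
          (io * s * (k.+1)%:R / 2 * tanhc (t k))
            *: (mu *: y k - mu *: z k - gradient f (y k))].

(* Main.v *)
Require Import Defs.
From HB Require Import structures.
From mathcomp Require Import all_boot all_order all_algebra.
From mathcomp Require Import all_classical all_reals all_analysis.
From mathcomp Require Import ring lra.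

Set Implicit Arguments.
Unset Strict Implicit.
Unset Printing Implicit Defensive.

Import Order.TTheory GRing.Theory Num.Theory.
Import numFieldNormedType.Exports.
Local Open Scope ring_scope.

(** Write [q] for [sqrt (mu s)], [p] for [1 - q] and [g k] for the coefficient of
    the [z]-update.  The rate comes from a Lyapunov function
      [E k = A k (f (x k) - f xstar) + (1 + mu A k) / 2 * |z k - xstar|^2],
    with the closed-form weight [A k = sinh^2 (- k ln p / 2) / mu] (so that
    [1 + mu A k = cosh^2 (- k ln p / 2)]), which degenerates to [s k^2 / 4] when
    [mu = 0].  Since [A 0 = 0], monotonicity of [E] gives
    [A k (f (x k) - f xstar) <= |x 0 - xstar|^2 / 2], and both rates are lower bounds on
    [A]: [sinh u >= u] and [- ln p >= q] give [A k >= s k^2 / 4] ([nag_weight_ge_sqr]), while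
    [1 - p^k >= q] gives [A k >= s / (4 p^k)] ([nag_weight_ge_exp]).  Hence
    [K = 2 / s] works.

    One step of the method is the usual estimate-sequence computation
    ([lyapunov_step]): it combines the gradient-step decrease
    [f (y - s grad f y) <= f y - s/2 |grad f y|^2] with the strong convexity
    inequalities from [y] to [x] and from [y] to [xstar].  For the cross terms to
    cancel, the weight [al] put on [f (x k) - f xstar] must satisfy a linear relation
    with the coefficient defining [y k]; this forces
    [al = A (k+1) - g k (1 + mu A (k+1))].  That weight is nonnegative as soon as
    [g k >= s], and it does not exceed [A k] ([nag_weight_succ]): after clearing the
    hyperbolic functions this is [1 + q <= 1 / (1 - q)].  At [k = 0]
    alone [g k < s]; there the relation is void because [x 0 = y 0 = z 0], and the
    weight [0] is used instead. *)

(** * The Euclidean inner product *)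

Section Euclid.
Variables (R : realType) (n : nat).
Implicit Types (u v w : 'rV[R]_n) (a : R).

Lemma dotvC u v : dotv u v = dotv v u.
Proof. by apply: eq_bigr => i _; rewrite mulrC. Qed.

Lemma dotvDl u v w : dotv (u + v) w = dotv u w + dotv v w.
Proof. by rewrite -big_split; apply: eq_bigr => i _; rewrite !mxE mulrDl. Qed.

Lemma dotvZl a u v : dotv (a *: u) v = a * dotv u v.
Proof. by rewrite mulr_sumr; apply: eq_bigr => i _; rewrite !mxE mulrA. Qed.

Lemma dotvNl u v : dotv (- u) v = - dotv u v.
Proof. by rewrite -scaleN1r dotvZl mulN1r. Qed.

Lemma dotvDr u v w : dotv u (v + w) = dotv u v + dotv u w.
Proof. by rewrite dotvC dotvDl !(dotvC _ u). Qed.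

Lemma dotvZr a u v : dotv u (a *: v) = a * dotv u v.
Proof. by rewrite dotvC dotvZl dotvC. Qed.

Lemma dotvNr u v : dotv u (- v) = - dotv u v.
Proof. by rewrite dotvC dotvNl dotvC. Qed.

Definition dotvE := (dotvDl, dotvDr, dotvZl, dotvZr, dotvNl, dotvNr).

Lemma dotv_ge0 u : 0 <= dotv u u.
Proof. by apply: sumr_ge0 => i _; rewrite -expr2 sqr_ge0. Qed.

Lemma enorm_sq u : enorm u ^+ 2 = dotv u u.
Proof. by rewrite sqr_sqrtr ?dotv_ge0. Qed.

Lemma enorm_ge0 u : 0 <= enorm u.
Proof. exact: sqrtr_ge0. Qed.

Lemma enormZ a u : 0 <= a -> enorm (a *: u) = a * enorm u.
Proof.
move=> a0; rewrite /enorm dotvZl dotvZr mulrA -expr2 sqrtrM ?sqr_ge0//.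
by rewrite sqrtr_sqr ger0_norm.
Qed.

(** Strictly positive bounds make it possible to divide by [a b] after expanding
    the square of [b u - a v]; vanishing norms need no separate case. *)
Lemma dotv_le_bounds u v a b : 0 < a -> 0 < b -> enorm u <= a -> enorm v <= b ->
  dotv u v <= a * b.
Proof.
move=> a0 b0 ua vb.
have h0 : 0 <= dotv (b *: u - a *: v) (b *: u - a *: v) by exact: dotv_ge0.
have ha : dotv u u <= a ^+ 2.
  by rewrite -enorm_sq lerXn2r ?nnegrE ?enorm_ge0 // ltW.
have hb : dotv v v <= b ^+ 2.
  by rewrite -enorm_sq lerXn2r ?nnegrE ?enorm_ge0 // ltW.
rewrite !dotvE (dotvC v u) in h0.
have ab0 : 0 < a * b by exact: mulr_gt0.
rewrite -(ler_pM2l ab0).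
have : b ^+ 2 * dotv u u <= b ^+ 2 * a ^+ 2 by rewrite ler_wpM2l ?sqr_ge0.
have : a ^+ 2 * dotv v v <= a ^+ 2 * b ^+ 2 by rewrite ler_wpM2l ?sqr_ge0.
by nra.
Qed.

Lemma cauchy_schwarz u v : dotv u v <= enorm u * enorm v.
Proof.
have nu := enorm_ge0 u; have nv := enorm_ge0 v.
(* The norms are perturbed by d, which costs at most
   d (|u| + |v| + d) <= d (1 + |u| + |v|) <= e in the product. *)
apply/ler_addgt0Pr => e e0.
pose d := Num.min 1 (e / (1 + enorm u + enorm v)).
have s0 : 0 < 1 + enorm u + enorm v by lra.
have d0 : 0 < d by rewrite lt_min ltr01 divr_gt0.
have d1 : d <= 1 by rewrite ge_min lexx.
have de : d * (1 + enorm u + enorm v) <= e.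
  by rewrite -ler_pdivlMr // ge_min lexx orbT.
have := @dotv_le_bounds u v (enorm u + d) (enorm v + d).
rewrite !ltr_wpDl // !lerDl (ltW d0) => /(_ isT isT isT isT) h.
have dd : d * d <= d * 1 by rewrite ler_wpM2l // ltW.
apply: (le_trans h); lra.
Qed.

(** The two sides differ by [a (1 - a) |u - v|^2]. *)
Lemma dotv_convex a u v : 0 <= a -> a <= 1 ->
  dotv ((1 - a) *: u + a *: v) ((1 - a) *: u + a *: v)
    <= (1 - a) * dotv u u + a * dotv v v.
Proof.
move=> a0 a1.
have : 0 <= a * (1 - a) * dotv (u - v) (u - v).
  by rewrite !mulr_ge0 ?dotv_ge0 // subr_ge0.
rewrite !dotvE (dotvC v u); lra.
Qed.

End Euclid.

(** * Smooth convex functions *)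

Section Descent.
Variables (R : realType) (n : nat) (f : 'rV[R]_n -> R) (L : R).
Hypothesis cvx : strongly_convex 0 f.
Hypothesis smo : smooth L f.

(** Walking from [y] along [v] in steps of length [h], convexity at the end point of
    each step bounds the increase of [f] by [h <grad f, v>] there, and the Lipschitz
    bound compares that gradient with the one at [y].  The sum of the errors is the
    right Riemann sum of [L t |v|^2]. *)
Lemma descent_subdivision (y v : 'rV[R]_n) (h : R) (i : nat) : 0 <= h ->
  f (y + (i%:R * h) *: v) <= f y + i%:R * h * dotv (gradient f y) v
     + L / 2 * (h ^+ 2 * (i%:R * i.+1%:R)) * enorm v ^+ 2.
Proof.
move=> h0; elim: i => [|i IH].
  by rewrite !mul0r scale0r addr0 !(mulr0, mul0r, addr0).
set p := y + (i%:R * h) *: v in IH *.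
set q := y + (i.+1%:R * h) *: v.
have ih0 : 0 <= i.+1%:R * h by rewrite mulr_ge0.
have pq : p - q = - (h *: v).
  rewrite /p /q -natr1 mulrDl mul1r scalerDl opprD addrACA subrr add0r.
  by rewrite opprD addrA subrr add0r.
have := cvx q p; rewrite pq !mul0r addr0 dotvNr dotvZr => hc.
have hg : dotv (gradient f q - gradient f y) v <= L * (i.+1%:R * h) * enorm v ^+ 2.
  apply: le_trans (cauchy_schwarz _ _) _.
  rewrite expr2 mulrA ler_wpM2r ?enorm_ge0 //.
  apply: le_trans (smo q y) _.
  by rewrite addrAC subrr add0r enormZ // mulrA.
rewrite dotvDl dotvNl in hg.
have : h * (dotv (gradient f q) v - dotv (gradient f y) v)
   <= h * (L * (i.+1%:R * h) * enorm v ^+ 2) by rewrite ler_wpM2l.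
have E : i.+1%:R = i%:R + 1 :> R by rewrite natr1.
have E2 : i.+2%:R = i%:R + 1 + 1 :> R by rewrite !natr1.
rewrite E2; rewrite E in IH *; lra.
Qed.

(** The limit of the subdivision estimate on the unit segment as the mesh tends to
    zero; no integration along the segment is involved. *)
Lemma descent (y v : 'rV[R]_n) :
  f (y + v) <= f y + dotv (gradient f y) v + L / 2 * enorm v ^+ 2.
Proof.
apply/ler_addgt0Pr => e e0.
set c := L / 2 * enorm v ^+ 2.
have [N hN] : exists N, `|c| / e <= N.+1%:R.
  exists (Num.bound (`|c| / e)); rewrite -natr1 ltW // ltr_wpDr // archi_boundP //.
  by rewrite divr_ge0 // ltW.
have N0 : 0 < N.+1%:R :> R by rewrite ltr0n.
have := @descent_subdivision y v (N.+1%:R^-1) N.+1.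
rewrite invr_ge0 ler0n mulfV ?gt_eqF // scale1r mul1r => /(_ isT) h.
apply: (le_trans h).
have -> : L / 2 * (N.+1%:R^-1 ^+ 2 * (N.+1%:R * N.+2%:R)) * enorm v ^+ 2
   = c + c / N.+1%:R by rewrite /c -(natr1 N.+1); field; rewrite nat1r gt_eqF.
have : c / N.+1%:R <= e.
  rewrite ler_pdivrMr // mulrC -ler_pdivrMr //.
  by apply: le_trans hN; rewrite ler_pM2r ?invr_gt0 // ler_norm.
by rewrite (addrA _ c) lerD2l.
Qed.

End Descent.

Lemma strongly_convexW (R : realType) (n : nat) (mu : R) (f : 'rV[R]_n -> R) :
  0 <= mu -> strongly_convex mu f -> strongly_convex 0 f.
Proof.
move=> mu0 h x y; apply: le_trans (h x y).
by rewrite !mul0r lerD2l mulr_ge0 ?sqr_ge0 // divr_ge0.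
Qed.

Lemma gradient_step (R : realType) (n : nat) (s : R) (f : 'rV[R]_n -> R)
    (y : 'rV[R]_n) :
  0 < s -> strongly_convex 0 f -> smooth (1 / s) f ->
  f (y - s *: gradient f y)
    <= f y - s / 2 * dotv (gradient f y) (gradient f y).
Proof.
move=> s0 cvx smo; have := @descent _ _ _ _ cvx smo y (- (s *: gradient f y)).
rewrite enorm_sq !dotvE => h; apply: (le_trans h).
rewrite le_eqVlt; apply/orP; left; apply/eqP; field.
by rewrite gt_eqF.
Qed.

(** * One step of the method *)

(** Let [w], [u] stand for [y - xstar], [z - xstar] and [c] for [mu g].  The updated [z]
    satisfies [z' - xstar = (1 - c) u + c w - g gr].  Expanding its square gives the
    cross term [- a <gr, (1 - c) u + c w>], which the coupling relation cancels
    against [alpha <gr, y - x> + a <gr, w>], coming from the convexity inequalities.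
    Convexity of the square produces [B c / 2 * |w|^2], which equals the term
    [a mu / 2 * |w|^2] supplied by strong convexity towards [xstar].  What remains in
    [|gr|^2] is nonpositive by [g a <= s (alpha + a)]. *)
Lemma lyapunov_step (R : realType) (n : nat) (mu s : R) (f : 'rV[R]_n -> R)
    (x y z xstar : 'rV[R]_n) (g B alpha : R) :
  let gr := gradient f y in
  let a := g * B in
  let z' := z + g *: (mu *: y - mu *: z - gr) in
  0 <= mu -> 0 < s -> strongly_convex mu f -> smooth (1 / s) f ->
  0 <= g -> mu * g <= 1 -> 0 <= B -> 0 <= alpha ->
  g * a <= s * (alpha + a) ->
  alpha *: (y - x) + (a * (1 - mu * g)) *: (y - z) = 0 ->
  (alpha + a) * (f (y - s *: gr) - f xstar)
    + B / 2 * dotv (z' - xstar) (z' - xstar)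
  <= alpha * (f x - f xstar)
    + B * (1 - mu * g) / 2 * dotv (z - xstar) (z - xstar).
Proof.
move=> gr a z' mu0 s0 scv smo g0 g1 B0 al0 hga hc.
have h1 := @gradient_step _ _ _ _ y s0 (@strongly_convexW _ _ _ _ mu0 scv) smo.
rewrite -/gr in h1.
have a0 : 0 <= a by exact: mulr_ge0.
have := scv y x; rewrite enorm_sq -/gr => h2.
have {h2} h2 : f y <= f x + dotv gr (y - x).
  have : 0 <= mu / 2 * dotv (x - y) (x - y).
    by rewrite mulr_ge0 ?dotv_ge0 // divr_ge0.
  have -> : dotv gr (y - x) = - dotv gr (x - y) by rewrite -dotvNr opprB.
  lra.
have := scv y xstar; rewrite enorm_sq -/gr => h3.
have yx : xstar - y = - (y - xstar) by rewrite opprB.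
rewrite yx !(dotvNl, dotvNr) opprK in h3.
set u := z - xstar in h3 *.
set w := y - xstar in h3 *.
have zE : z' - xstar = ((1 - mu * g) *: u + (mu * g) *: w) - g *: gr.
  by apply/rowP => i; rewrite !mxE; ring.
have hc' : alpha * dotv gr (y - x) + a * (1 - mu * g) * (dotv gr w - dotv gr u) = 0.
  have := congr1 (dotv gr) hc.
  have -> : y - z = w - u by rewrite /w /u opprB addrA subrK.
  rewrite !(dotvDr, dotvZr, dotvNr) => ->.
  by rewrite -(scale0r 0) dotvZr mul0r.
have mg0 : 0 <= mu * g by exact: mulr_ge0.
have hv := @dotv_convex _ _ (mu * g) u w mg0 g1.
rewrite zE.
have -> m : dotv (m - g *: gr) (m - g *: gr)
    = dotv m m - 2 * g * dotv gr m + g ^+ 2 * dotv gr gr.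
  by rewrite !dotvE (dotvC m gr); ring.
set Nm := dotv _ _ in hv *.
clearbody u w; rewrite !(dotvDr, dotvZr).
set G := dotv gr gr in h1 *; have G0 : 0 <= G by exact: dotv_ge0.
have k1 : (alpha + a) * (f (y - s *: gr) - f y + s / 2 * G) <= 0.
  by rewrite mulr_ge0_le0 ?addr_ge0 //; lra.
have k2 : alpha * (f y - f x - dotv gr (y - x)) <= 0.
  by rewrite mulr_ge0_le0 //; lra.
have k3 : a * (f y - f xstar - dotv gr w + mu / 2 * dotv w w) <= 0.
  by rewrite mulr_ge0_le0 //; lra.
have k4 : B / 2 * (Nm - ((1 - mu * g) * dotv u u + mu * g * dotv w w)) <= 0.
  by rewrite mulr_ge0_le0 ?divr_ge0 //; lra.
have k5 : (s * (alpha + a) - g * a) * (G / 2) >= 0.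
  by rewrite mulr_ge0 ?divr_ge0 //; lra.
rewrite /a in k1 k2 k3 k5 hc' *.
lra.
Qed.

(** * The schedule of step sizes and weights *)

Definition nag_gain (R : realType) (mu s : R) (k : nat) : R :=
  nag_iota mu s * s * k.+1%:R / 2
    * tanhc (k.+1%:R / 2 * nag_iota mu s * Num.sqrt (mu * s)).

(** For [mu > 0] this is [sinh^2 u / mu] at [u = - k ln p / 2], written in powers of
    [p] because [expR (2 u) = p^-k]; at [mu = 0] it is the limit of that value. *)
Definition nag_weight (R : realType) (mu s : R) (k : nat) : R :=
  let p := 1 - Num.sqrt (mu * s) in
  if 0 < mu then (1 - p ^+ k) ^+ 2 / (4 * mu * p ^+ k) else s * k%:R ^+ 2 / 4.

Lemma tanh_ln (R : realType) (p : R) (k : nat) : 0 < p ->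
  tanh (- (k%:R / 2 * ln p)) = (1 - p ^+ k) / (1 + p ^+ k).
Proof.
move=> p0; set t := k%:R / 2 * ln p.
have pk : p ^+ k = expR t ^+ 2.
  rewrite -expRM_natl /t; have -> : 2%:R * (k%:R / 2 * ln p) = k%:R * ln p by field.
  by rewrite expRM_natl lnK.
have e0 : 0 < expR t by exact: expR_gt0.
have h : 0 < 1 + expR t ^+ 2 by rewrite ltr_wpDr ?sqr_ge0.
rewrite /tanh opprK expRN pk; field.
by rewrite !gt_eqF.
Qed.

Lemma nag_gain_mu_pos (R : realType) (mu s q : R) (k : nat) :
  q = Num.sqrt (mu * s) -> 0 < mu -> 0 < q -> q < 1 ->
  nag_gain mu s k = s / q * ((1 - (1 - q) ^+ k.+1) / (1 + (1 - q) ^+ k.+1)).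
Proof.
move=> qE mu0 q0 q1; have p0 : 0 < 1 - q by lra.
have l0 : ln (1 - q) < 0 by rewrite ln_lt0 //; lra.
rewrite /nag_gain /nag_iota mu0 /= -qE.
set t := _ / 2 * _ * q.
have tE : t = - (k.+1%:R / 2 * ln (1 - q)) by rewrite /t; field; exact: lt0r_neq0.
have k0 : 0 < k.+1%:R :> R by rewrite ltr0n.
have t0 : t != 0 by rewrite tE oppr_eq0 !mulf_eq0 invr_eq0 !pnatr_eq0 (lt_eqF l0).
rewrite /tanhc (negPf t0) -tanh_ln // -tE.
move: (tanh t) => T; rewrite tE; field.
by rewrite nat1r (gt_eqF k0) (gt_eqF q0) (lt_eqF l0).
Qed.

Lemma nag_gain_mu0 (R : realType) (s : R) (k : nat) :
  nag_gain 0 s k = s * k.+1%:R / 2.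
Proof.
by rewrite /nag_gain /nag_iota /tanhc ltxx mul0r sqrtr0 mulr0 eqxx mulr1 mul1r.
Qed.

Lemma natrS (R : realType) (k : nat) : k.+1%:R = k%:R + 1 :> R.
Proof. by rewrite natr1. Qed.

Lemma bernoulli_one_sub (R : realType) (r : R) (k : nat) : 0 <= r -> r <= 1 ->
  1 - k%:R * (1 - r) <= r ^+ k.
Proof.
move=> r0 r1; elim: k => [|k IH]; first by rewrite mul0r subr0 expr0.
have h1 : (1 - k%:R * (1 - r)) * r <= r ^+ k * r by rewrite ler_wpM2r.
rewrite exprSr natrS; apply: le_trans h1; rewrite -subr_ge0.
have -> : (1 - k%:R * (1 - r)) * r - (1 - (k%:R + 1) * (1 - r))
  = k%:R * (1 - r) ^+ 2 by ring.
by rewrite mulr_ge0 ?sqr_ge0.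
Qed.

(** For [r = expR (- u / k)] this reads [k (1 - r^2) <= 2 sinh u], a consequence of
    [1 - r^2 <= 2 u / k] and [u <= sinh u]; Bernoulli's inequality proves it without
    the exponential. *)
Lemma one_minus_pow_ge (R : realType) (r : R) (k : nat) : 0 <= r -> r <= 1 ->
  k%:R * (1 - r ^+ 2) * r ^+ k <= 1 - (r ^+ 2) ^+ k.
Proof.
move=> r0 r1; elim: k => [|k IH]; first by rewrite !mul0r !expr0 subrr.
have bern := bernoulli_one_sub k r0 r1.
have q0 : 0 <= 1 - r ^+ 2 by rewrite subr_ge0 exprn_ile1.
have rk : 0 <= r ^+ k by exact: exprn_ge0.
have E m : (r ^+ 2) ^+ m = (r ^+ m) ^+ 2 by rewrite exprAC.
rewrite E in IH; rewrite E (exprSr r k) natrS.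
rewrite -subr_ge0; set e := (X in 0 <= X).
have -> : e = (1 - (r ^+ k) ^+ 2 - k%:R * (1 - r ^+ 2) * r ^+ k)
  + (1 - r ^+ 2) * r ^+ k * ((r ^+ k - (1 - k%:R * (1 - r))) + (1 - r)).
  by rewrite /e; ring.
by rewrite addr_ge0 ?subr_ge0 // !mulr_ge0 // addr_ge0 ?subr_ge0.
Qed.

Section Schedule.
Variables (R : realType) (mu s : R).
Hypotheses (hmu : 0 <= mu) (hs : 0 < s) (hmus : mu * s < 1).
Local Notation q := (Num.sqrt (mu * s)).
Local Notation g := (nag_gain mu s).
Local Notation A := (nag_weight mu s).

Let mu_cases : 0 < mu \/ 0 = mu.
Proof. by move: hmu; rewrite le_eqVlt => /predU1P[|]; [right|left]. Qed.

Let q_lt1 : q < 1.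
Proof. by rewrite -sqrtr1 ltr_sqrt. Qed.

Let q_gt0 : 0 < mu -> 0 < q.
Proof. by move=> mu0; rewrite sqrtr_gt0 mulr_gt0. Qed.

Let q_sq : q ^+ 2 = mu * s.
Proof. by rewrite sqr_sqrtr // mulr_ge0 // ltW. Qed.

Lemma nag_weight_mu0 k : mu = 0 -> A k = s * k%:R ^+ 2 / 4.
Proof. by rewrite /nag_weight => ->; rewrite ltxx. Qed.

Lemma nag_weight_mu_pos k : 0 < mu ->
  A k = (1 - (1 - q) ^+ k) ^+ 2 / (4 * mu * (1 - q) ^+ k).
Proof. by rewrite /nag_weight => ->. Qed.

Lemma nag_weight0 : A 0 = 0.
Proof.
rewrite /nag_weight; case: ifP => _.
  by rewrite expr0 subrr expr0n mul0r.
by rewrite expr0n mulr0 mul0r.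
Qed.

Lemma nag_weight_ge0 k : 0 <= A k.
Proof.
have s0 := ltW hs; have p0 : 0 <= 1 - q by rewrite subr_ge0 ltW.
rewrite /nag_weight; case: ifP => _;
  by rewrite divr_ge0 // ?sqr_ge0 // !mulr_ge0 ?sqr_ge0 ?exprn_ge0.
Qed.

Let pow_lt1 k : 0 < mu -> 0 < (1 - q) ^+ k.+1 < 1.
Proof.
move=> mu0; have := q_gt0 mu0 => q0.
by rewrite exprn_gt0 ?subr_gt0 //= exprn_ilt1 // ?subr_ge0 ?ltW // gtrBl.
Qed.

Lemma nag_gain_gt0 k : 0 < g k.
Proof.
case: mu_cases => [mu0|mu0]; last by rewrite -mu0 nag_gain_mu0 divr_gt0 ?mulr_gt0 // ltr0n.
have /andP[r0 r1] := pow_lt1 k mu0.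
by rewrite (nag_gain_mu_pos _ erefl) ?q_gt0 // mulr_gt0 // divr_gt0 ?q_gt0 //; lra.
Qed.

(** With [T] the hyperbolic tangent in [g k], this is
    [sinh^2 = T^2 cosh^2]; it is what makes the [|grad f|^2] terms balance exactly. *)
Lemma nag_weight_gain k : s * A k.+1 = g k ^+ 2 * (1 + mu * A k.+1).
Proof.
case: mu_cases => [mu0|mu0]; last first.
  by rewrite nag_weight_mu0 // -mu0 nag_gain_mu0; field.
have /andP[r0 r1] := pow_lt1 k mu0; have q0 := q_gt0 mu0.
rewrite nag_weight_mu_pos // (nag_gain_mu_pos _ erefl) //.
set r := (1 - q) ^+ k.+1 in r0 r1 *.
have -> : (s / q * ((1 - r) / (1 + r))) ^+ 2 = s / mu * ((1 - r) / (1 + r)) ^+ 2.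
  rewrite exprMn expr_div_n q_sq; field; rewrite !gt_eqF //; lra.
field; rewrite !gt_eqF //; lra.
Qed.

(** For [mu > 0] the two sides differ by [q^2 p^k / (4 mu)], a multiple of
    [1 / (1 - q) - (1 + q)]; for [mu = 0] they differ by [s / 4]. *)
Lemma nag_weight_succ k : A k.+1 - g k * (1 + mu * A k.+1) <= A k.
Proof.
case: mu_cases => [mu0|mu0]; last first.
  rewrite !nag_weight_mu0 // -mu0 nag_gain_mu0 natrS.
  have : 0 <= s by exact: ltW.
  lra.
have /andP[r0 r1] := pow_lt1 k mu0; have q0 := q_gt0 mu0.
rewrite !nag_weight_mu_pos // (nag_gain_mu_pos _ erefl) //.
rewrite exprS in r0 r1 *.
have p0 : 0 < 1 - q by rewrite subr_gt0.
have c0 : 0 < (1 - q) ^+ k by exact: exprn_gt0.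
set c := (1 - q) ^+ k in c0 r0 r1 *.
have sq : s / q = q / mu.
  apply: (mulIf (lt0r_neq0 q0)); rewrite divfK ?(lt0r_neq0 q0) // mulrAC -expr2.
  by rewrite q_sq mulrC mulKf // lt0r_neq0.
rewrite sq -subr_ge0.
set e := (X in 0 <= X).
have -> : e = q ^+ 2 * c / (4 * mu).
  by rewrite /e; field; rewrite !gt_eqF //; lra.
by rewrite divr_ge0 // mulr_ge0 ?sqr_ge0 // ltW.
Qed.

(** The first step is the only one with gain below [s]: the hyperbolic tangent is
    [q / (2 - q) <= q] at [k = 0] and at least [q (2 - q) / (1 + p^2) >= q] later. *)
Lemma nag_gain0_le : g 0 <= s.
Proof.
case: mu_cases => [mu0|mu0]; last first.
  by rewrite -mu0 nag_gain_mu0 mulr1 ler_pdivrMr // ler_peMr ?ler1n // ltW.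
have /andP[r0 r1] := pow_lt1 0 mu0; have q0 := q_gt0 mu0.
rewrite (nag_gain_mu_pos _ erefl) // expr1 in r0 r1 *.
have qq : 0 <= q * (1 - q) by rewrite mulr_ge0 // ltW // subr_gt0.
rewrite mulrAC ler_pdivrMr // -subr_ge0.
have -> : s * q - s * ((1 - (1 - q)) / (1 + (1 - q))) = s * (q * (1 - q)) / (2 - q).
  field; rewrite gt_eqF //; lra.
by rewrite divr_ge0 ?mulr_ge0 ?(ltW hs) //; lra.
Qed.

Lemma nag_gainS_ge k : s <= g k.+1.
Proof.
case: mu_cases => [mu0|mu0].
  have /andP[r0 r1] := pow_lt1 k.+1 mu0; have q0 := q_gt0 mu0.
  rewrite (nag_gain_mu_pos _ erefl) //.
  have rp : (1 - q) ^+ k.+2 <= (1 - q) ^+ 2.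
    by rewrite ler_wiXn2l ?subr_ge0 ?gerBl ?ltW.
  set r := _ ^+ k.+2 in r0 r1 rp *.
  rewrite mulrAC ler_pdivlMr // -subr_ge0.
  (* The numerator is p - r (1 + q), rearranged to use r <= p^2. *)
  have -> : s * ((1 - r) / (1 + r)) - s * q
    = s * (((1 - q) ^+ 2 - r) * (1 + q) + q ^+ 2 * (1 - q)) / (1 + r).
    field; rewrite gt_eqF //; lra.
  have : 0 <= ((1 - q) ^+ 2 - r) * (1 + q) by rewrite mulr_ge0 //; lra.
  have : 0 <= q ^+ 2 * (1 - q) by rewrite mulr_ge0 ?sqr_ge0 // subr_ge0 ltW.
  move=> h1 h2; apply: divr_ge0; last by lra.
  by apply: mulr_ge0; [exact: ltW | exact: addr_ge0].
by rewrite -mu0 nag_gain_mu0 -mulrA ler_peMr ?(ltW hs) // ler_pdivlMr // mul1r ler_nat.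
Qed.

Lemma nag_weight_ge_sqr k : s / 4 * k%:R ^+ 2 <= A k.
Proof.
case: mu_cases => [mu0|mu0]; last by rewrite nag_weight_mu0 //; lra.
have q0 := q_gt0 mu0; have p0 : 0 < 1 - q by rewrite subr_gt0.
pose r := Num.sqrt (1 - q).
have r0 : 0 < r by rewrite sqrtr_gt0.
have rr : r ^+ 2 = 1 - q by rewrite sqr_sqrtr // ltW.
have r1 : r <= 1 by rewrite -sqrtr1 ler_sqrt //; lra.
have := @one_minus_pow_ge _ r k (ltW r0) r1; rewrite rr => h.
have qE : 1 - (1 - q) = q by lra.
rewrite qE in h.
have h2 : (k%:R * q * r ^+ k) ^+ 2 <= (1 - (1 - q) ^+ k) ^+ 2.
  apply: lerXn2r h; rewrite nnegrE.
      by rewrite !mulr_ge0 ?exprn_ge0 // ltW.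
    by rewrite subr_ge0 exprn_ile1 // ?gerBl ltW.
rewrite !exprMn q_sq exprAC rr in h2.
have c0 : 0 < (1 - q) ^+ k by exact: exprn_gt0.
rewrite nag_weight_mu_pos // ler_pdivlMr ?mulr_gt0 //; lra.
Qed.

Lemma nag_weight_ge_exp k : (0 < k)%N -> s / 4 <= A k * (1 - q) ^+ k.
Proof.
case: k => // k _; case: mu_cases => [mu0|mu0]; last first.
  rewrite nag_weight_mu0 // -mu0 mul0r sqrtr0 subr0 expr1n mulr1.
  have : 1 <= k.+1%:R ^+ 2 :> R by rewrite expr_ge1 // ler1n.
  have := hs; nra.
have /andP[r0 r1] := pow_lt1 k mu0; have q0 := q_gt0 mu0.
have rq : (1 - q) ^+ k.+1 <= (1 - q) ^+ 1.
  by rewrite ler_wiXn2l ?subr_ge0 ?gerBl ?ltW.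
rewrite nag_weight_mu_pos //; set r := _ ^+ k.+1 in r0 r1 rq *.
have -> : (1 - r) ^+ 2 / (4 * mu * r) * r = (1 - r) ^+ 2 / (4 * mu).
  by field; rewrite !gt_eqF.
rewrite ler_pdivlMr ?mulr_gt0 //.
have : q ^+ 2 <= (1 - r) ^+ 2 by rewrite expr1 in rq; apply: lerXn2r; rewrite ?nnegrE; lra.
rewrite q_sq; lra.
Qed.

End Schedule.

(** * Monotonicity of the Lyapunov function *)

Section Convergence.
Variables (R : realType) (n : nat) (mu s : R) (f : 'rV[R]_n -> R).
Variables (xstar : 'rV[R]_n) (x y z : nat -> 'rV[R]_n).
Hypotheses (hmu : 0 <= mu) (hs : 0 < s) (hmus : mu * s < 1).
Hypotheses (scv : strongly_convex mu f) (smo : smooth (1 / s) f).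
Hypotheses (hmin : is_minimizer f xstar) (hnag : unified_NAG mu s f x y z).
Local Notation g := (nag_gain mu s).
Local Notation A := (nag_weight mu s).

Definition lyapunov k : R :=
  A k * (f (x k) - f xstar)
    + (1 + mu * A k) / 2 * dotv (z k - xstar) (z k - xstar).

(** The same [cothc] that defines [y k] is the inverse of the [tanhc] in [g k], so
    the coefficient depends on the schedule only through [s / g k]. *)
Lemma nag_coupling k :
  y k = x k + ((s / g k - mu * s) / (1 - mu * s)) *: (z k - x k).
Proof.
case: hnag => _ /(_ k)[-> _ _]; congr (_ + (_ - _) / _ *: _).
rewrite /cothc mul1r /nag_gain.
set T := tanhc _; set io := nag_iota _ _.
have s0 : s != 0 by rewrite gt_eqF.
rewrite !invfM invrK; move: (io^-1) (k.+1%:R^-1) (T^-1) => a b c.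
by field.
Qed.

(** The weight on [f (x k) - f xstar] for which [lyapunov_step] applies.  The
    last relation forces its value unless [y k = x k]; that value is negative at [k = 0], where all three points coincide and [0] can be
    taken instead. *)
Lemma coupling_weight k :
  let a := g k * (1 + mu * A k.+1) in
  exists al, [/\ 0 <= al, al <= A k, A k.+1 <= al + a,
    g k * a <= s * (al + a)
    & al *: (y k - x k) + (a * (1 - mu * g k)) *: (y k - z k) = 0].
Proof.
move=> a.
have g0 := nag_gain_gt0 hmu hs hmus k.
have hA := nag_weight_gain hmu hs hmus k.
have hAS := nag_weight_succ hmu hs hmus k.
have AS0 := nag_weight_ge0 hmu hs hmus k.+1.
have hc := nag_coupling k.
have a0 : 0 <= a by rewrite mulr_ge0 ?(ltW g0) // addr_ge0 // mulr_ge0.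
case: k => [|k] in a g0 hA hAS AS0 hc a0 *.
  exists 0; rewrite add0r; split => //.
  - by rewrite nag_weight0.
  - by move: hAS; rewrite nag_weight0 subr_le0.
  - by rewrite ler_wpM2r // (nag_gain0_le hmu hs hmus).
  - have [xz0 _] := hnag.
    by rewrite hc xz0 subrr !scaler0 addr0 subrr !scaler0 addr0.
have gs := nag_gainS_ge hmu hs hmus k.
have alE : s * (A k.+2 - a) = a * (g k.+1 - s) by rewrite mulrBr hA /a; ring.
exists (A k.+2 - a); rewrite subrK; split => //.
- by rewrite -(pmulr_rge0 _ hs) alE mulr_ge0 // subr_ge0.
- by rewrite hA /a mulrA -expr2.
(* In this form the coupling relation is a rational identity in g, mu and s. *)
have -> : A k.+2 - a = a * (g k.+1 - s) / s by rewrite -alE mulrC mulKf // lt0r_neq0.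
rewrite hc; apply/rowP => i; rewrite !mxE.
move: (g k.+1) g0 (a) => gk gk0 b; field.
by rewrite !lt0r_neq0 // subr_gt0.
Qed.

Lemma lyapunov_noninc k : lyapunov k.+1 <= lyapunov k.
Proof.
have [_ /(_ k)[_ xS zS]] := hnag.
have g0 := nag_gain_gt0 hmu hs hmus k.
have AS0 := nag_weight_ge0 hmu hs hmus k.+1.
have hA := nag_weight_gain hmu hs hmus k.
have hAS := nag_weight_succ hmu hs hmus k.
have [al []] := coupling_weight k.
rewrite /lyapunov zS -/(nag_gain mu s k).
set B := 1 + mu * A k.+1 in hA hAS *.
move=> al0 alA ale hga hc.
have B_gt0 : 0 < B by rewrite ltr_pwDl // mulr_ge0.
have B0 := ltW B_gt0.
have D0 : 0 <= f (x k.+1) - f xstar by rewrite subr_ge0.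
have Dk0 : 0 <= f (x k) - f xstar by rewrite subr_ge0.
have mg : mu * g k <= 1.
  (* By the gain identity, (mu g)^2 B = mu s * mu A <= mu A <= B. *)
  have : (mu * g k) ^+ 2 * B <= 1 ^+ 2 * B.
    rewrite exprMn -mulrA -hA expr1n mul1r /B.
    have : mu * A k.+1 * (mu * s) <= mu * A k.+1 * 1.
      by rewrite ler_wpM2l ?mulr_ge0 // ltW.
    lra.
  by rewrite ler_pM2r // ler_sqr ?nnegrE // mulr_ge0 // ltW.
have hB : B * (1 - mu * g k) <= 1 + mu * A k.
  have : mu * (A k.+1 - g k * B) <= mu * A k by rewrite ler_wpM2l.
  rewrite /B; lra.
have step := lyapunov_step xstar hmu hs scv smo (ltW g0) mg B0 al0 hga hc.
rewrite -xS in step.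
have h1 : A k.+1 * (f (x k.+1) - f xstar)
    <= (al + g k * B) * (f (x k.+1) - f xstar) by rewrite ler_wpM2r.
have h2 : al * (f (x k) - f xstar) <= A k * (f (x k) - f xstar).
  by rewrite ler_wpM2r.
have h3 : B * (1 - mu * g k) / 2 * dotv (z k - xstar) (z k - xstar)
    <= (1 + mu * A k) / 2 * dotv (z k - xstar) (z k - xstar).
  by rewrite ler_wpM2r ?dotv_ge0 // ler_pM2r.
apply: le_trans (lerD h2 h3); apply: le_trans step.
by rewrite lerD2r.
Qed.

Lemma nag_rate k :
  A k * (f (x k) - f xstar) <= enorm (x 0%N - xstar) ^+ 2 / 2.
Proof.
have h : lyapunov k <= lyapunov 0.
  by elim: k => // k; apply: le_trans (lyapunov_noninc k).
case: hnag => xz0 _.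
rewrite {2}/lyapunov nag_weight0 // -xz0 -enorm_sq in h.
have : 0 <= (1 + mu * A k) / 2 * dotv (z k - xstar) (z k - xstar).
  rewrite mulr_ge0 ?dotv_ge0 // divr_ge0 // addr_ge0 //.
  by rewrite mulr_ge0 // (nag_weight_ge0 hmu hs hmus).
rewrite /lyapunov in h; lra.
Qed.

End Convergence.

Theorem mainTheorem11 (R : realType) (mu s : R)
    (hmu : 0 <= mu) (hs : 0 < s) (hmus : mu * s < 1) :
  exists2 K : R, 0 < K &
    forall (n : nat) (f : 'rV[R]_n -> R) (xstar : 'rV[R]_n)
        (x y z : nat -> 'rV[R]_n),
      continuously_differentiable f ->
      strongly_convex mu f ->
      smooth (1 / s) f ->
      is_minimizer f xstar ->
      unified_NAG mu s f x y z ->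
      forall k : nat, (1 <= k)%N ->
        f (x k) - f xstar <=
          K * Num.min (1 / k%:R ^+ 2) ((1 - Num.sqrt (mu * s)) ^+ k)
            * enorm (x 0%N - xstar) ^+ 2.
Proof.
exists (2 / s); first by rewrite divr_gt0.
move=> n f xstar x y z _ scv smo hmin hnag k k1.
have rate := nag_rate hmu hs hmus scv smo hmin hnag k.
have D0 : 0 <= f (x k) - f xstar by rewrite subr_ge0.
move: (enorm _ ^+ 2) rate => N rate.
(* Each of the two rates m is a positive number with A k * m >= s / 4. *)
suff bound m : 0 < m -> s / 4 <= nag_weight mu s k * m ->
    f (x k) - f xstar <= 2 / s * m * N.
  rewrite /Num.min; case: ifP => _; apply: bound.
  - by rewrite divr_gt0 // exprn_gt0 // ltr0n.
  - rewrite mul1r ler_pdivlMr ?exprn_gt0 ?ltr0n //.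
    exact: nag_weight_ge_sqr.
  - by rewrite exprn_gt0 // subr_gt0 -sqrtr1 ltr_sqrt.
  - exact: nag_weight_ge_exp.
move=> m0 hm.
have h1 : m * (nag_weight mu s k * (f (x k) - f xstar)) <= m * (N / 2).
  by rewrite ler_pM2l.
have h2 : s / 4 * (f (x k) - f xstar) <= nag_weight mu s k * m * (f (x k) - f xstar).
  by rewrite ler_wpM2r.
have -> : 2 / s * m * N = (2 * m * N) / s by field; exact: lt0r_neq0.
by rewrite ler_pdivlMr //; lra.
Qed.
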